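(* Let $X = X_1 \oplus X_2$ be a complex Banach space which is the direct sum of closed subspaces $X_1$ and $X_2$, let $I_i$ be the identity operator on $X_i$ ($i = 1, 2$), and let $B : X_2 \to X_1$ and $C : X_1 \to X_2$ be bounded linear operators. The operator $$T = \left(\begin{matrix} 0 & B \\ C & 0 \end{matrix}\right)$$ on $X$ is a commutator of the idempotent $P = \left(\begin{matrix} I_1 & 0 \\ 0 & 0 \end{matrix}\right)$ and some idempotent operator $Q$ on $X$ if and only if the operator $BC + \frac14 I_1$ has a square root $S_1$ on $X_1$ and the operator $CB + \frac14 I_2$ has a square root $S_2$ on $X_2$ such that $S_1 B = B S_2$ and $S_2 C = C S_1$.
   Context: ''Operator'' means bounded linear operator. Operator matrices are taken with respect to the decomposition $X = X_1 \oplus X_2$, so $T(x_1 + x_2) = B x_2 + C x_1$ and $P(x_1 + x_2) = x_1$ for $x_i \in X_i$. An operator $Q$ is idempotent if $Q^2 = Q$. $T$ is a commutator of $P$ and $Q$ if $T = PQ - QP$. A square root of an operator $A$ on a Banach space $Y$ is a bounded linear operator $S$ on $Y$ with $S^2 = A$. *)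

(* Defs.v *)
From HB Require Import structures.
From mathcomp Require Import all_boot all_order all_algebra.
From mathcomp Require Import complex.
From mathcomp Require Import boolp classical_sets reals topology normedtype.

Set Implicit Arguments.
Unset Strict Implicit.
Unset Printing Implicit Defensive.

Import Order.TTheory GRing.Theory Num.Theory.
Import numFieldNormedType.Exports.

Local Open Scope classical_set_scope.
Local Open Scope ring_scope.

Section Submodule.
Context {K : numFieldType} {X : normedModType K} (S : submodClosed X).

Inductive submod_of : predArgType := Submod u & u \in S.

Definition submod_val (w : submod_of) : X := let: Submod u _ := w in u.

HB.instance Definition _ := [isSub of submod_of for submod_val].
HB.instance Definition _ := [Choice of submod_of by <:].
HB.instance Definition _ := [SubChoice_isSubLmodule of submod_of by <:].

Definition submod_norm (w : submod_of) : K := `|val w|.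

Let submod_normD (v w : submod_of) :
  submod_norm (v + w) <= submod_norm v + submod_norm w.
Proof. by rewrite /submod_norm raddfD ler_normD. Qed.

Let submod_normZ (l : K) (v : submod_of) :
  submod_norm (l *: v) = `|l| * submod_norm v.
Proof. by rewrite /submod_norm linearZ normrZ. Qed.

Let submod_norm_eq0 (v : submod_of) : submod_norm v = 0 -> v = 0.
Proof. by move=> /normr0_eq0 v0; apply: val_inj; rewrite v0 raddf0. Qed.

HB.instance Definition _ := @Lmodule_isNormed.Build K submod_of
  submod_norm submod_normD submod_normZ submod_norm_eq0.

Lemma submod_normE (w : submod_of) : `|w| = `|val w|.
Proof. by []. Qed.

End Submodule.

(* Equivalent to an estimate |f x| <= r * |x|: see linear_boundedP. *)
Definition bounded_op (K : numFieldType) (V W : normedModType K)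
  (f : {linear V -> W}) : Prop := bounded_near f (nbhs (0 : V)).

Definition square_root_op (K : numFieldType) (V : normedModType K)
  (S : {linear V -> V}) (A : V -> V) : Prop := bounded_op S /\ S \o S =1 A.

Definition commutator_of (V : zmodType) (T P Q : V -> V) : Prop :=
  T =1 (P \o Q) \- (Q \o P).

(* Algebraic direct sum; continuity of the projections is not required here. *)
Definition direct_sum (K : numFieldType) (X : normedModType K)
    (X1 X2 : submodClosed X) : Prop :=
  (forall x : X, exists2 x1, x1 \in X1 & exists2 x2, x2 \in X2 & x = x1 + x2)
  /\ (forall x : X, x \in X1 -> x \in X2 -> x = 0).

(* The X1-component of x along X2; the default value 0 is never used when X is
   the direct sum of X1 and X2. *)
Definition component (K : numFieldType) (X : normedModType K)
    (X1 X2 : submodClosed X) (x : X) : submod_of X1 :=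
  xget 0 [set x1 : submod_of X1 | x - val x1 \in X2].

Lemma direct_sumC (K : numFieldType) (X : normedModType K)
  (X1 X2 : submodClosed X) : direct_sum X1 X2 -> direct_sum X2 X1.
Proof.
move=> X12; split=> [x|x xX2 xX1]; last exact: X12.2.
by have [y1 ? [y2 ? ->]] := X12.1 x; exists y2 => //; exists y1; rewrite // addrC.
Qed.

Lemma componentE (K : numFieldType) (X : normedModType K)
    (X1 X2 : submodClosed X) (x1 : submod_of X1) (x2 : submod_of X2) :
  direct_sum X1 X2 -> component X1 X2 (val x1 + val x2) = x1.
Proof.
move=> [_ X12]; rewrite /component.
have subX (S : submodClosed X) : {in S &, forall u v, u - v \in S}.
  by move=> u v uS vS; rewrite -scaleN1r rpredD// rpredZ.
apply: xget_unique => [|y] /=; first by rewrite addrAC subrr add0r; exact: valP.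
move=> yX2; apply: val_inj; apply: subr0_eq; apply: X12.
  by apply: subX; rewrite //; exact: valP.
rewrite (_ : _ - _ = val x2 - (val x1 + val x2 - val y)).
  by apply: subX; rewrite //; exact: valP.
by rewrite opprB opprD [RHS]addrC addrA subrK.
Qed.

Definition op_matrix (K : numFieldType) (X : normedModType K)
    (X1 X2 : submodClosed X)
    (A11 : submod_of X1 -> submod_of X1) (A12 : submod_of X2 -> submod_of X1)
    (A21 : submod_of X1 -> submod_of X2) (A22 : submod_of X2 -> submod_of X2)
    (x : X) : X :=
  let x1 := component X1 X2 x in
  let x2 := component X2 X1 x in
  val (A11 x1 + A12 x2) + val (A21 x1 + A22 x2).

Arguments op_matrix {K X} X1 X2 A11 A12 A21 A22 x.

Lemma op_matrixE (K : numFieldType) (X : normedModType K)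
    (X1 X2 : submodClosed X) (A11 : submod_of X1 -> submod_of X1)
    (A12 : submod_of X2 -> submod_of X1) (A21 : submod_of X1 -> submod_of X2)
    (A22 : submod_of X2 -> submod_of X2)
    (x1 : submod_of X1) (x2 : submod_of X2) : direct_sum X1 X2 ->
  op_matrix X1 X2 A11 A12 A21 A22 (val x1 + val x2) =
  val (A11 x1 + A12 x2) + val (A21 x1 + A22 x2).
Proof.
move=> X12; rewrite /op_matrix componentE//.
by rewrite [val x1 + val x2]addrC componentE//; exact: direct_sumC.
Qed.

(* Main.v *)
Require Import Defs.
From HB Require Import structures.
From mathcomp Require Import all_boot all_order all_algebra.
From mathcomp Require Import complex.
From mathcomp Require Import boolp classical_sets reals topology normedtype.
From mathcomp Require Import ring lra.

Set Implicit Arguments.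
Unset Strict Implicit.
Unset Printing Implicit Defensive.

Import Order.TTheory GRing.Theory Num.Theory.
Import numFieldNormedType.Exports.

Local Open Scope classical_set_scope.
Local Open Scope ring_scope.

(** Write an operator on X as a 2 x 2 matrix of operators between X1 and X2.
    The commutator of P with a matrix keeps the upper right entry, changes the
    sign of the lower left one and kills the diagonal.  Hence T = PQ - QP says
    exactly that the off-diagonal entries of Q are B and - C
    ([commutator_matrix_operator]).  On the other hand Q is idempotent if and
    only if M := Q - 1/2 satisfies M^2 = 1/4 ([idempotent_add_half]), and
    subtracting 1/2 changes neither the off-diagonal entries nor the
    commutator with P.  If S1 and - S2 are the diagonal entries of M, then

      M = [[S1, B], [- C, - S2]],
      M^2 = [[S1^2 - BC, S1 B - B S2], [S2 C - C S1, S2^2 - CB]],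

    so that M^2 = 1/4 is word for word the system S1^2 = BC + 1/4,
    S2^2 = CB + 1/4, S1 B = B S2, S2 C = C S1
    ([matrix_operator_square_scalar]).

    There remains boundedness: Q is bounded if and only if its entries are,
    and this rests on the continuity of the two projections of X = X1 + X2.
    These have closed graphs, because X1 and X2 are closed, and so are
    continuous by the closed graph theorem ([closed_graph_continuous]).
    That theorem is proved here over the complex numbers: by a Baire category
    argument ([baire_cover]) some sublevel set of x |-> |f x| is dense in a
    ball; by homogeneity every vector z is then approximated, as closely as
    one wishes, by vectors a with |f a| <= c |z| for a fixed c
    ([dense_sublevel_approx]); correcting the error by half at each step
    writes z as the sum of a series whose image under f converges
    geometrically, and closedness identifies the sum of the image with f z. *)

(** * Sequences with geometrically decreasing steps *)

Lemma halving_lt {R : realType} (r : nat -> R) (e : R) :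
  (forall k, r k.+1 <= r k / 2) -> 0 < e ->
  exists n, forall k, (n <= k)%N -> r k < e.
Proof.
move=> rhalf e0.
have rpow k : r k * 2 ^+ k <= r 0%N.
  elim: k => [|k IH]; first by rewrite expr0 mulr1.
  apply: le_trans IH; rewrite exprS mulrA ler_pM2r ?exprn_gt0//.
  by have := rhalf k; lra.
exists (Num.truncn (r 0%N / e)).+1 => k nk; rewrite -(ltr_pM2r (exprn_gt0 k (ltr0Sn R 1))).
apply: le_lt_trans (rpow k) _; rewrite mulrC -ltr_pdivrMr//.
apply: lt_le_trans (truncnS_gt _) _; rewrite -natrX ler_nat.
by rewrite (leq_trans nk)// ltnW// ltn_expl.
Qed.

Section RealNorm.
Context {R : realType} {V : normedModType R[i]}.
Implicit Types (x y : V) (u : nat -> V).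

(** A norm with values in R[i] lives in a partially ordered field, where
    dichotomies and the archimedean property are awkward; its real part
    carries the same information. *)
Definition real_norm x : R := complex.Re `|x|.

Lemma real_normE x : ((real_norm x)%:C)%C = `|x|.
Proof. by rewrite /real_norm RRe_real// ger0_real. Qed.

Lemma real_normD x y : real_norm (x + y) <= real_norm x + real_norm y.
Proof. by rewrite -lecR rmorphD/= !real_normE ler_normD. Qed.

Lemma real_normN x : real_norm (- x) = real_norm x.
Proof. by rewrite /real_norm normrN. Qed.

Lemma real_normB x y : real_norm (x - y) = real_norm (y - x).
Proof. by rewrite -real_normN opprB. Qed.

Lemma real_norm0 : real_norm 0 = 0.
Proof. by apply: complexI; rewrite real_normE normr0. Qed.

Lemma real_norm_gt0 x : (0 < real_norm x) = (x != 0).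
Proof. by rewrite -ltcR real_normE normr_gt0. Qed.

Lemma real_normZ (t : R) x : 0 <= t ->
  real_norm ((t%:C)%C *: x) = t * real_norm x.
Proof.
move=> t0; apply: complexI; rewrite rmorphM/= !real_normE normrZ.
by rewrite ger0_norm// ler0c.
Qed.

Lemma cvg_real_normP u l :
  u @ \oo --> l <->
  forall e : R, 0 < e -> \forall n \near \oo, real_norm (l - u n) < e.
Proof.
split=> [/cvgrPdist_lt ul e e0|ul].
  have := ul (e%:C)%C; rewrite ltcR => /(_ e0); apply: filterS => n.
  by rewrite -real_normE ltcR.
apply/cvgrPdist_lt => e e0.
have eE : e = ((complex.Re e)%:C)%C by rewrite RRe_real// gtr0_real.
move: e0; rewrite eE ltcR => /ul; apply: filterS => n.
by rewrite -real_normE ltcR.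
Qed.

Lemma cvg_halving u l (r : nat -> R) :
  (forall k, r k.+1 <= r k / 2) -> (forall k, real_norm (l - u k) <= r k) ->
  u @ \oo --> l.
Proof.
move=> rhalf ur; apply/cvg_real_normP => e e0.
have [n rn] := halving_lt rhalf e0.
by exists n => // k /= nk; rewrite (le_lt_trans (ur k))// rn.
Qed.

End RealNorm.

(** The remaining steps after index k add up to at most
    r k / 2 + r k / 4 + ... = r k, whence both the Cauchy property and the
    bound on the distance from the limit. *)
Lemma cvg_of_halving {R : realType} {V : completeNormedModType R[i]}
    (u : nat -> V) (r : nat -> R) :
  (forall k, 0 <= r k) -> (forall k, r k.+1 <= r k / 2) ->
  (forall k, real_norm (u k.+1 - u k) <= r k / 2) ->
  exists2 l, u @ \oo --> l & forall k, real_norm (l - u k) <= r k.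
Proof.
move=> r0 rhalf ur.
(* The telescoping bound r k - r (k + m) makes the induction go through. *)
have dist k m : real_norm (u (k + m)%N - u k) <= r k - r (k + m)%N.
  elim: m => [|m IH]; first by rewrite addn0 !subrr real_norm0.
  rewrite addnS -(subrKA (u (k + m)%N)) (le_trans (real_normD _ _))//.
  have := ur (k + m)%N; have := rhalf (k + m)%N; lra.
have dist_le k n : (k <= n)%N -> real_norm (u n - u k) <= r k.
  by move=> kn; have := dist k (n - k)%N; have := r0 n; rewrite subnKC//; lra.
have : cvg (u @ \oo).
  apply: cauchy_cvg; apply: cauchy_exP => e e0.
  have eE : e = ((complex.Re e)%:C)%C by rewrite RRe_real// gtr0_real.
  move: e0; rewrite eE ltcR => /(halving_lt rhalf)[n rn]; exists (u n), n => //.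
  move=> k /= nk; rewrite -ball_normE /ball_/= -real_normE ltcR real_normB.
  by rewrite (le_lt_trans (dist_le _ _ nk))// rn.
move=> /cvg_ex[l ul]; exists l => // k; rewrite leNgt; apply/negP => rk.
have /cvg_real_normP/(_ (real_norm (l - u k) - r k)) := ul.
rewrite subr_gt0 => /(_ rk)[n _ /(_ (maxn n k))] /= /(_ (leq_maxl _ _)).
have := dist_le k (maxn n k) (leq_maxr _ _).
have := real_normD (l - u (maxn n k)) (u (maxn n k) - u k).
rewrite subrKA; lra.
Qed.

(** * The closed graph theorem over the complex numbers *)

(** The Baire category theorem for a countable cover: one of the sets is dense
    in some closed ball.  Otherwise each closed ball contains a smaller one, of
    at most half the radius, that avoids the next set of the cover; the centers
    of such nested balls converge to a point that no set of the cover
    contains. *)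
Lemma baire_cover {R : realType} {V : completeNormedModType R[i]}
    (A : nat -> set V) : (forall x, exists n, A n x) ->
  exists n x (r : R), 0 < r /\
    forall y, real_norm (y - x) <= r ->
    forall e, 0 < e -> exists2 a, A n a & real_norm (y - a) < e.
Proof.
move=> Acover; apply: contrapT => nodense.
have step (q : nat * (V * R)) : exists q' : V * R, 0 < q.2.2 ->
    [/\ 0 < q'.2, q'.2 <= q.2.2 / 2, real_norm (q'.1 - q.2.1) <= q.2.2 / 2
      & forall a, A q.1 a -> q'.2 < real_norm (q'.1 - a)].
  case: q => n [x r] /=; have [r0|r0] := ltP 0 r; last by exists (x, r).
  apply: contrapT => nostep; apply: nodense; exists n, x, (r / 2).
  split=> [|y yx e e0]; first by rewrite divr_gt0.
  apply: contrapT => noa; apply: nostep.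
  (* The radius stays strictly below the distance e to A n, so that even the
     limit of the centers is kept away from A n. *)
  exists (y, Num.min (e / 2) (r / 2)) => _ /=; split=> //.
  - by rewrite lt_min !divr_gt0.
  - by rewrite ge_min lexx orbT.
  - move=> a Aa; rewrite gt_min; apply/orP; left.
    suff : e <= real_norm (y - a) by lra.
    by rewrite leNgt; apply/negP => ea; apply: noa; exists a.
have [f fP] := choice step.
pose fix s n := if n is p.+1 then f (p, s p) else (0, 1).
have s_gt0 n : 0 < (s n).2.
  by elim: n => //= n IH; have [] := fP (n, s n) IH.
have sS n := fP (n, s n) (s_gt0 n).
have [|||l _ sl] := @cvg_of_halving R V (fun n => (s n).1) (fun n => (s n).2).
- by move=> k; exact: ltW.
- by move=> k; have [] := sS k.
- by move=> k; have [] := sS k.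
have [n Al] := Acover l; have [_ _ _ /(_ l Al)] := sS n.
by rewrite real_normB ltNge; have /= -> := sl n.+1.
Qed.

Section ClosedGraph.
Context {R : realType} {V W : completeNormedModType R[i]}.
Variable f : {linear V -> W}.

(** If {x | |f x| <= n} is dense in a ball around x, then differences of its
    elements, on which |f| is at most 2 n, come arbitrarily close to every
    vector of the ball of the same radius around 0; homogeneity extends this to all vectors. *)
Lemma dense_sublevel_approx : exists2 M : R, 0 <= M &
  forall z e, 0 < e ->
    exists2 a, real_norm (z - a) < e & real_norm (f a) <= M * real_norm z.
Proof.
have [|n [x [r [r0 rA]]]] := @baire_cover R V
    (fun n => [set x | real_norm (f x) <= n%:R]).
  by move=> x; exists (Num.truncn (real_norm (f x))).+1; exact/ltW/truncnS_gt.
have approx z e : real_norm z <= r -> 0 < e ->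
    exists2 a, real_norm (z - a) < e & real_norm (f a) <= 2 * n%:R.
  move=> zr e0; have e20 : 0 < e / 2 by rewrite divr_gt0.
  have [|a fa xza] := rA (x + z) _ _ e20; first by rewrite addrAC subrr add0r.
  have [|b fb xb] := rA x _ _ e20; first by rewrite subrr real_norm0 ltW.
  exists (a - b).
    have -> : z - (a - b) = (x + z - a) - (x - b).
      by rewrite !opprB [x + z]addrC -!addrA [x + _]addrCA [x + _]addrC subrK
        [b - a]addrC.
    have := real_normD (x + z - a) (- (x - b)); rewrite real_normN; lra.
  rewrite linearB (le_trans (real_normD _ _))// real_normN mulr_natl mulr2n.
  exact: lerD.
exists (2 * n%:R / r) => [|z e e0]; first by rewrite divr_ge0// ?mulr_ge0// ltW.
have [->|z0] := eqVneq z 0.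
  by exists 0; rewrite ?subrr ?linear0 !real_norm0 ?mulr0.
have nz0 : 0 < real_norm z by rewrite real_norm_gt0.
(* Rescale z to norm r, approximate there, and scale back. *)
pose t := r / real_norm z.
have t0 : 0 < t by rewrite divr_gt0.
have tC0 : (t%:C)%C != 0 by rewrite gt_eqF// ltcR.
have tzr : real_norm ((t%:C)%C *: z) <= r.
  by rewrite real_normZ ?(ltW t0)// divfK// gt_eqF.
have [a za fa] := approx ((t%:C)%C *: z) (t * e) tzr (mulr_gt0 t0 e0).
exists (((t^-1)%:C)%C *: a).
  rewrite -(ltr_pM2l t0) -real_normZ ?(ltW t0)//.
  by rewrite scalerBr scalerA -rmorphM/= divff ?gt_eqF// scale1r.
rewrite linearZ real_normZ ?invr_ge0 ?(ltW t0)//.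
rewrite /t invf_div [leRHS](_ : _ = real_norm z / r * (2 * n%:R)); last by ring.
by rewrite ler_pM2l// divr_gt0.
Qed.

(** Closedness is asked along sequences only, which is the form that the
    projections of a direct sum satisfy at once. *)
Theorem closed_graph_continuous :
  (forall u x y, u @ \oo --> x -> f \o u @ \oo --> y -> f x = y) ->
  continuous f.
Proof.
move=> fclosed; have [M M0 approx] := dense_sublevel_approx.
have f_le z : real_norm (f z) <= 2 * M * real_norm z.
  have [->|z0] := eqVneq z 0; first by rewrite linear0 !real_norm0 mulr0.
  pose D := real_norm z; have D0 : 0 < D by rewrite real_norm_gt0.
  have step (q : nat * V) : exists a, real_norm (z - q.2 - a) < D / 2 ^+ q.1.+1
      /\ real_norm (f a) <= M * real_norm (z - q.2).
    have [|a] := approx (z - q.2) (D / 2 ^+ q.1.+1); last by exists a.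
    by rewrite divr_gt0// exprn_gt0.
  have [g gP] := choice step.
  (* The partial sums of a series for z: each term approximates the current
     error, so that the error is halved and the image of the term is at most
     M times the current error. *)
  pose fix s n := if n is p.+1 then s p + g (p, s p) else 0.
  have sz n : real_norm (z - s n) <= D / 2 ^+ n.
    case: n => [|n] /=; first by rewrite subr0 expr0 divr1.
    by rewrite opprD addrA ltW//; have [] := gP (n, s n).
  have halfS c n : c / 2 ^+ n.+1 = c / 2 ^+ n / 2 :> R.
    by rewrite exprSr invfM mulrA.
  have [|||y fsy fs_le] :=
    @cvg_of_halving R W (f \o s) (fun n => 2 * M * D / 2 ^+ n).
  - by move=> k; rewrite divr_ge0 ?mulr_ge0 ?exprn_ge0// ltW.
  - by move=> k; rewrite halfS.
  - move=> k /=; rewrite linearD [f (s k) + _]addrC addrK.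
    have [_ /le_trans-> //] := gP (k, s k).
    rewrite (_ : _ / 2 = M * (D / 2 ^+ k)); last by field; rewrite ?expf_neq0 ?pnatr_eq0.
    by rewrite ler_wpM2l//= sz.
  have -> : f z = y.
    apply: fclosed fsy; apply: cvg_halving sz => k.
    by rewrite halfS.
  by have := fs_le 0%N; rewrite /= linear0 subr0 expr0 divr1.
apply/linear_bounded_continuous/bounded_funP => r.
exists ((2 * M)%:C%C * r) => x xr; apply: (@le_trans _ _ ((2 * M)%:C%C * `|x|)).
  by rewrite -!real_normE -rmorphM lecR.
by rewrite ler_wpM2l// ler0c mulr_ge0.
Qed.

End ClosedGraph.

(** * Operator matrices on a direct sum *)

Section DirectSum.
Context {K : numFieldType} {X : normedModType K} {X1 X2 : submodClosed X}.
Hypothesis X12 : direct_sum X1 X2.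
Let X21 : direct_sum X2 X1 := direct_sumC X12.

Lemma component_add x : val (component X1 X2 x) + val (component X2 X1 x) = x.
Proof.
have [y1 y1X [y2 y2X ->]] := X12.1 x.
have := componentE (Submod y1X) (Submod y2X) X12.
have := componentE (Submod y2X) (Submod y1X) X21.
by rewrite /= addrC => -> ->.
Qed.

Lemma direct_sumP (x1 y1 : submod_of X1) (x2 y2 : submod_of X2) :
  val x1 + val x2 = val y1 + val y2 <-> x1 = y1 /\ x2 = y2.
Proof.
split=> [xy|[-> ->]//]; split.
  by rewrite -(componentE x1 x2 X12) xy componentE.
by rewrite -(componentE x2 x1 X21) addrC xy addrC componentE.
Qed.

End DirectSum.

Section ComponentLinear.
Context {K : numFieldType} {X : normedModType K} {X1 X2 : submodClosed X}.

Lemma component_is_linear (X12 : direct_sum X1 X2) : linear (component X1 X2).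
Proof.
move=> a x y; rewrite -{1}(component_add X12 x) -{1}(component_add X12 y).
by rewrite scalerDr addrACA -!linearP componentE.
Qed.

(** [component] carries no proof that the sum is direct; making this proof an
    argument allows the canonical structure of a linear map. *)
Definition projection (X12 : direct_sum X1 X2) : X -> submod_of X1 := component X1 X2.

HB.instance Definition _ (X12 : direct_sum X1 X2) := GRing.isLinear.Build K X (submod_of X1) _
  (projection X12) (component_is_linear X12).

End ComponentLinear.

Section MatrixOperator.
Context {K : numFieldType} {X : normedModType K} {X1 X2 : submodClosed X}.
Variable X12 : direct_sum X1 X2.

(** The operator [op_matrix X1 X2 A11 A12 A21 A22], to which it is convertible,
    packaged as a linear map. *)
Definition matrix_operator
  (A11 : {linear submod_of X1 -> submod_of X1})
  (A12 : {linear submod_of X2 -> submod_of X1})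
  (A21 : {linear submod_of X1 -> submod_of X2})
  (A22 : {linear submod_of X2 -> submod_of X2}) : {linear X -> X} :=
  (val \o ((A11 \o projection X12) \+ (A12 \o projection (direct_sumC X12))))
  \+ (val \o ((A21 \o projection X12) \+ (A22 \o projection (direct_sumC X12)))).

End MatrixOperator.

Section MatrixOperatorTheory.
Context {K : numFieldType} {X : normedModType K} {X1 X2 : submodClosed X}.
Variable X12 : direct_sum X1 X2.
Local Notation p1 := (projection X12).
Local Notation p2 := (projection (direct_sumC X12)).

Lemma matrix_operatorE A11 A12 A21 A22 x1 x2 :
  matrix_operator X12 A11 A12 A21 A22 (val x1 + val x2) =
  val (A11 x1 + A12 x2) + val (A21 x1 + A22 x2).
Proof. exact: op_matrixE X12. Qed.

Lemma eq_on_direct_sum (f g : X -> X) :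
  (forall (x1 : submod_of X1) (x2 : submod_of X2),
     f (val x1 + val x2) = g (val x1 + val x2)) -> f =1 g.
Proof. by move=> fg x; rewrite -(component_add X12 x) fg. Qed.

Lemma matrix_operator_blocks (M : {linear X -> X}) :
  M =1 matrix_operator X12 (p1 \o (M \o val)) (p1 \o (M \o val))
                           (p2 \o (M \o val)) (p2 \o (M \o val)).
Proof.
apply: eq_on_direct_sum => x1 x2; rewrite matrix_operatorE.
rewrite -[LHS](component_add X12) linearD.
by congr +%R; apply: congr1; [exact: (linearD p1)|exact: (linearD p2)].
Qed.

(** P M - M P = [[0, A12], [- A21, 0]]: the commutator with P sees exactly the
    off-diagonal entries. *)
Lemma commutator_matrix_operator B C A11 A12 A21 A22 :
  commutator_of (op_matrix X1 X2 (fun=> 0) B C (fun=> 0))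
    (op_matrix X1 X2 idfun (fun=> 0) (fun=> 0) (fun=> 0))
    (matrix_operator X12 A11 A12 A21 A22) <->
  A12 =1 B /\ A21 =1 \- C.
Proof.
set T := op_matrix _ _ _ B _ _; set P := op_matrix _ _ _ _ _ _.
set M := matrix_operator _ _ _ _ _.
have TE x1 x2 : T (val x1 + val x2) = val (B x2) + val (C x1).
  by rewrite /T op_matrixE// add0r addr0.
have PE (x1 : submod_of X1) (x2 : submod_of X2) :
    P (val x1 + val x2) = val x1 + val (0 : submod_of X2).
  by rewrite /P op_matrixE// addr0 add0r.
have ME x1 x2 : M (val x1 + val x2) =
    val (A11 x1 + A12 x2) + val (A21 x1 + A22 x2) by exact: matrix_operatorE.
have PME x1 x2 : P (M (val x1 + val x2)) - M (P (val x1 + val x2)) =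
    val (A12 x2) + val (- A21 x1).
  rewrite (PE x1 x2) !ME PE !linear0 !addr0 (raddfN val) (raddfD val).
  by rewrite opprD addrACA subrr add0r.
split=> [TPM|[A12E A21E]].
  have blocks x1 x2 : B x2 = A12 x2 /\ C x1 = - A21 x1.
    by apply/(direct_sumP X12); rewrite -TE TPM /= PME.
  split=> [x2|x1] /=; first by have [] := blocks 0 x2.
  by have [_ ->] := blocks x1 0; rewrite opprK.
apply: eq_on_direct_sum => x1 x2; rewrite TE /= PME A12E A21E /=.
by rewrite opprK.
Qed.

(** The square of [[S1, B], [- C, - S2]] is
    [[S1^2 - BC, S1 B - B S2], [S2 C - C S1, S2^2 - CB]]; the signs of the
    entries are chosen so that its off-diagonal entries are intertwining
    relations. *)
Lemma matrix_operator_square_scalar (S1 : {linear submod_of X1 -> submod_of X1})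
    (S2 : {linear submod_of X2 -> submod_of X2})
    (B : {linear submod_of X2 -> submod_of X1})
    (C : {linear submod_of X1 -> submod_of X2}) (a : K) :
  let M := matrix_operator X12 S1 B (\- C) (\- S2) in
  M \o M =1 a \*: idfun <->
  [/\ S1 \o S1 =1 (B \o C) \+ (a \*: idfun),
      S2 \o S2 =1 (C \o B) \+ (a \*: idfun),
      S1 \o B =1 B \o S2 & S2 \o C =1 C \o S1].
Proof.
move=> M.
have ME x1 x2 : M (val x1 + val x2) =
    val (S1 x1 + B x2) + val (- C x1 - S2 x2) by exact: matrix_operatorE.
have MME x1 x2 : M (M (val x1 + val x2)) =
    val (S1 (S1 x1) - B (C x1) + (S1 (B x2) - B (S2 x2))) +
    val (S2 (C x1) - C (S1 x1) + (S2 (S2 x2) - C (B x2))).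
  rewrite !ME; apply/(direct_sumP X12).
  rewrite /= !linearD !linearN /= ?opprK ?opprD.
  by split; [rewrite addrACA|rewrite addrC addrACA].
split=> [MM|[S1E S2E SB SC]].
  have blocks x1 x2 :
      S1 (S1 x1) - B (C x1) + (S1 (B x2) - B (S2 x2)) = a *: x1 /\
      S2 (C x1) - C (S1 x1) + (S2 (S2 x2) - C (B x2)) = a *: x2.
    by apply/(direct_sumP X12); rewrite -MME [LHS]MM/= scalerDr ?linearZ.
  split=> x /=.
  - have [+ _] := blocks x 0; rewrite !linear0 ?subr0 ?addr0 ?add0r ?scaler0.
    by move/eqP; rewrite subr_eq addrC => /eqP.
  - have [_] := blocks 0 x; rewrite !linear0 ?subr0 ?addr0 ?add0r ?scaler0.
    by move/eqP; rewrite subr_eq addrC => /eqP.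
  - have [+ _] := blocks 0 x; rewrite !linear0 ?subr0 ?addr0 ?add0r ?scaler0.
    exact: subr0_eq.
  - have [_] := blocks x 0; rewrite !linear0 ?subr0 ?addr0 ?add0r ?scaler0.
    exact: subr0_eq.
apply: eq_on_direct_sum => x1 x2; rewrite [LHS]MME /=.
move: (S1E x1) (S2E x2) (SB x2) (SC x1) => /= -> -> -> ->.
by rewrite !subrr addr0 add0r ![_ + a *: _]addrC !addrK scalerDr ?linearZ.
Qed.

End MatrixOperatorTheory.

Section ShiftByScalar.
Context {K : numFieldType} {V : lmodType K}.
Implicit Type M : {linear V -> V}.

(** Completing the square: Q^2 - Q = (Q - 1/2)^2 - 1/4. *)
Lemma idempotent_add_half M :
  idempotent_fun (M \+ 2^-1 \*: idfun) <-> M \o M =1 4^-1 \*: idfun.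
Proof.
have halfD (x : V) : 2^-1 *: x + 2^-1 *: x = x.
  by rewrite -scalerDl -[2^-1]mul1r -splitr scale1r.
have quarterD (x : V) : 4^-1 *: x + 4^-1 *: x = 2^-1 *: x.
  by rewrite -scalerDl; congr (_ *: x); field.
have E x : (M \+ 2^-1 \*: idfun) ((M \+ 2^-1 \*: idfun) x) =
    M (M x) - 4^-1 *: x + (M x + 2^-1 *: x).
  rewrite /= linearD linearZ/= scalerDr scalerA addrA -[_ + _ + 2^-1 *: M x]addrA.
  have -> : 2^-1 * 2^-1 = 4^-1 :> K by field.
  by rewrite halfD addrACA -[2^-1 *: x]quarterD addKr.
split=> [QQ x|MM x]; last by rewrite [LHS]E [M (M x)]MM subrr add0r.
by apply: subr0_eq; apply: (addIr (M x + 2^-1 *: x)); rewrite -E add0r -[RHS]QQ.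
Qed.

Lemma commutator_add_scale (T : V -> V) (P : {linear V -> V}) (Q : V -> V)
    (a : K) :
  commutator_of T P (Q \+ a \*: idfun) <-> commutator_of T P Q.
Proof.
have E : (P \o (Q \+ a \*: idfun)) \- ((Q \+ a \*: idfun) \o P) =1
    (P \o Q) \- (Q \o P).
  by move=> x /=; rewrite linearD linearZ/= opprD addrACA subrr addr0.
by split=> TPQ x; rewrite TPQ E.
Qed.

End ShiftByScalar.

(** * Boundedness *)

Section BoundedOperators.
Context {K : numFieldType} {U V W : normedModType K}.

Lemma bounded_op_comp (f : {linear U -> V}) (g : {linear V -> W}) :
  bounded_op f -> bounded_op g -> bounded_op (g \o f).
Proof.
move=> /linear_bounded_continuous fc /linear_bounded_continuous gc.
apply/linear_bounded_continuous => x.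
exact: (continuous_comp (fc x) (gc (f x))).
Qed.

Lemma bounded_opD (f g : {linear U -> V}) :
  bounded_op f -> bounded_op g -> bounded_op (f \+ g).
Proof.
move=> /linear_bounded_continuous fc /linear_bounded_continuous gc.
apply/linear_bounded_continuous => x.
exact: (continuousD (fc x) (gc x)).
Qed.

Lemma bounded_opN (f : {linear U -> V}) : bounded_op f -> bounded_op (\- f).
Proof.
move=> /linear_bounded_continuous fc; apply/linear_bounded_continuous => x.
exact: (continuousN (fc x)).
Qed.

Lemma bounded_op_scale (a : K) : bounded_op (a \*: idfun : {linear U -> U}).
Proof.
apply/bounded_funP => r; exists (`|a| * r) => x xr /=.
by rewrite normrZ ler_wpM2l.
Qed.

Lemma bounded_op_val (S : submodClosed U) :
  bounded_op (val : {linear submod_of S -> U}).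
Proof. by apply/bounded_funP => r; exists r => x. Qed.

End BoundedOperators.

Section BoundedProjections.
Context {R : realType} {X : completeNormedModType R[i]} {X1 X2 : submodClosed X}.
Hypothesis X1_closed : closed [set x : X | x \in X1].
Hypothesis X2_closed : closed [set x : X | x \in X2].
Variable X12 : direct_sum X1 X2.

(** The closed graph theorem asks for complete spaces, and completeness is given
    for X, so it is applied to the projection as a map from X to X.  If u n --> x and its components in X1
    converge to y, then y lies in X1 and x - y lies in X2 by closedness, so y is
    the component of x. *)
Lemma bounded_projection : bounded_op (projection X12).
Proof.
suff : continuous (val \o projection X12 : {linear X -> X}).
  by move/linear_bounded_continuous.
apply: closed_graph_continuous => u x y ux uy.
have yX1 : y \in X1.
  apply: (closed_cvg _ X1_closed _ _ uy).
  by apply: nearW => n; exact: valP.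
have xyX2 : x - y \in X2.
  apply: (closed_cvg _ X2_closed _ _ (cvgB ux uy)).
  apply: nearW => n; suff : u n - val (component X1 X2 (u n)) \in X2 by [].
  by rewrite -{1}(component_add X12 (u n)) addrC addKr; exact: valP.
have := componentE (Submod yX1) (Submod xyX2) X12.
by rewrite /= addrC subrK /projection => ->.
Qed.

End BoundedProjections.

(** * Commutators of idempotents and square roots *)

Theorem theorem2p2 (R : realType) (X : completeNormedModType R[i])
    (X1 X2 : submodClosed X)
    (X1_closed : closed [set x : X | x \in X1])
    (X2_closed : closed [set x : X | x \in X2])
    (X12 : direct_sum X1 X2)
    (B : {linear submod_of X2 -> submod_of X1})
    (C : {linear submod_of X1 -> submod_of X2})
    (B_bounded : bounded_op B) (C_bounded : bounded_op C) :
  let T := op_matrix X1 X2 (fun=> 0) B C (fun=> 0) in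
  let P := op_matrix X1 X2 idfun (fun=> 0) (fun=> 0) (fun=> 0) in
  (exists Q : {linear X -> X},
      [/\ bounded_op Q, idempotent_fun Q & commutator_of T P Q])
  <->
  (exists (S1 : {linear submod_of X1 -> submod_of X1})
          (S2 : {linear submod_of X2 -> submod_of X2}),
      [/\ square_root_op S1 (B \o C \+ (4^-1 \*: idfun)),
          square_root_op S2 (C \o B \+ (4^-1 \*: idfun)),
          S1 \o B =1 B \o S2 & S2 \o C =1 C \o S1]).
Proof.
move=> T P.
have p1_bounded := bounded_projection X1_closed X2_closed X12.
have p2_bounded := bounded_projection X2_closed X1_closed (direct_sumC X12).
have half_commutator M : commutator_of T P (M \+ 2^-1 \*: idfun) <->
    commutator_of T P M.
  exact: (commutator_add_scale T (matrix_operator X12 idfun \0 \0 \0)).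
split=> [[Q [Q_bounded QQ TPQ]]|[S1 [S2 [[S1b S1E] [S2b S2E] SB SC]]]].
- pose M : {linear X -> X} := Q \- 2^-1 \*: idfun.
  have QE : Q =1 M \+ 2^-1 \*: idfun by move=> x; rewrite /= subrK.
  have M_bounded : bounded_op M.
    exact: bounded_opD Q_bounded (bounded_opN (bounded_op_scale _)).
  have ME := matrix_operator_blocks X12 M.
  move: TPQ; rewrite (funext QE) => /half_commutator.
  rewrite (funext ME) => /commutator_matrix_operator[A12E A21E].
  pose S1 : {linear submod_of X1 -> submod_of X1} :=
    projection X12 \o (M \o val).
  pose S2 : {linear submod_of X2 -> submod_of X2} :=
    \- (projection (direct_sumC X12) \o (M \o val)).
  have {}ME : M =1 matrix_operator X12 S1 B (\- C) (\- S2).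
    apply: (eq_on_direct_sum X12) => x1 x2; rewrite ME !matrix_operatorE.
    by rewrite A12E A21E /S2 /= opprK.
  move: QQ; rewrite (funext QE) => /idempotent_add_half; rewrite (funext ME).
  move=> /matrix_operator_square_scalar[S1E S2E SB SC].
  exists S1, S2; split=> //; split=> //.
    exact: bounded_op_comp (bounded_op_comp (bounded_op_val _) M_bounded) _.
  apply: bounded_opN.
  exact: bounded_op_comp (bounded_op_comp (bounded_op_val _) M_bounded) _.
- pose M := matrix_operator X12 S1 B (\- C) (\- S2).
  exists (M \+ 2^-1 \*: idfun); split.
  + apply: bounded_opD (bounded_op_scale _); apply: bounded_opD.
      apply: bounded_op_comp (bounded_op_val _).
      by apply: bounded_opD; exact: bounded_op_comp.
    apply: bounded_op_comp (bounded_op_val _).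
    by apply: bounded_opD; apply: bounded_op_comp => //; exact: bounded_opN.
  + exact/idempotent_add_half/matrix_operator_square_scalar.
  + by apply/half_commutator/commutator_matrix_operator.
Qed.
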